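(* Let $\langle F,E\rangle$ be a weak-* sequentially complete anti-dual pair, and let $A,B\in\mathscr{L}(E;F)$ be positive operators. Then the operator $A_r:=(A:B)\div B$ exists and belongs to $\mathscr{L}(E;F)$, and the decomposition $$A=A_r+(A-A_r)$$ is a Lebesgue-type decomposition of $A$ with respect to $B$ (that is, $A_r$ is $B$-absolutely continuous, and $A-A_r$ and $B$ are mutually singular). Furthermore, $$A_r=\lim_{n\to\infty}A:(nB)$$ in the sense of pointwise convergence.
   Context: An anti-dual pair $\langle F,E\rangle$ is a pair of complex vector spaces $E,F$ together with a separating sesquilinear map $\langle\cdot,\cdot\rangle:F\times E\to\mathbb{C}$ (linear in the $F$-variable, conjugate-linear in the $E$-variable). $E$ and $F$ are endowed with the weak topologies $\sigma(E,F)$ and $\sigma(F,E)$. The pair is weak-* sequentially complete if $(F,\sigma(F,E))$ is sequentially complete. $\mathscr{L}(E;F)$ is the set of everywhere defined weakly continuous linear operators $E\to F$. $A\in\mathscr{L}(E;F)$ is positive if $\langle Ax,x\rangle\geq0$ for all $x\in E$; $A\leq A'$ means $A'-A$ is positive. Pointwise convergence of operators $E\to F$ is with respect to $\sigma(F,E)$. Complement: for positive $A,B\in\mathscr{L}(E;F)$ the complement $A_B$ is the smallest positive operator $C\in\mathscr{L}(E;F)$ such that the operator matrix $\begin{bmatrix} A & B \\ B & C \end{bmatrix}:E\times E\to F\times F$ is positive (the pairing on products being the sum of the pairings). It exists if and only if for every $y\in E$ there is $M_y\geq 0$ with $|\langle Bx,y\rangle|^2\leq M_y\langle Ax,x\rangle$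 for all $x\in E$, and in that case $\langle A_By,y\rangle=\sup\{\langle By,x\rangle+\langle Bx,y\rangle-\langle Ax,x\rangle:x\in E\}$. Parallel sum: for positive $A,B\in\mathscr{L}(E;F)$, $(A+B)_A$ always exists and the parallel sum is $A:B:=A-(A+B)_A$. It is a positive operator in $\mathscr{L}(E;F)$ with $\langle (A:B)y,y\rangle=\inf\{\langle A(y+x),y+x\rangle+\langle Bx,x\rangle:x\in E\}$. Parallel difference: if $A,B\in\mathscr{L}(E;F)$ are positive operators with $A-B\geq0$ such that the complement $(A-B)_A$ exists, the parallel difference of $B$ and $A$ is $B\div A:=(A-B)_A-A\in\mathscr{L}(E;F)$; its quadratic form is $\langle (B\div A)y,y\rangle=\sup\{\langle B(x+y),x+y\rangle-\langle Ax,x\rangle:x\in E\}$. Absolute continuity and singularity: for positive $A,B\in\mathscr{L}(E;F)$, $A$ is $B$-absolutely continuous ($A\ll B$) if for any sequence $(x_n)$ in $E$, $\langle Bx_n,x_n\rangle\to0$ and $\langle A(x_n-x_m),x_n-x_m\rangle\to 0$ ($n,m\to\infty$) imply $\langle Ax_n,x_n\rangle\to0$. $A$ and $B$ are mutually singular ($A\perp B$) if $C\leq A$ and $C\leq B$ imply $C=0$ for any positive $C\in\mathscr{L}(E;F)$. A decomposition $A=A_1+A_2$ (into positive operators) is a Lebesgue-type decomposition of $A$ with respect to $B$ if $A_1\ll B$ and $A_2\perp B$. *)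

(* Defs.v *)
From HB Require Import structures.
From mathcomp Require Import all_boot all_order all_algebra.
From mathcomp Require Import complex.
From mathcomp Require Import all_classical all_reals all_analysis.
Import Order.TTheory GRing.Theory Num.Theory.
Import numFieldNormedType.Exports.

Set Implicit Arguments.
Unset Strict Implicit.
Unset Printing Implicit Defensive.

Local Open Scope classical_set_scope.
Local Open Scope ring_scope.

(* [pairing p f x] is <f, x>: linear in f : F, conjugate-linear in x : E. *)
Record antidual_pair (R : realType) (F E : lmodType R[i]) := AntidualPair {
  pairing :> {bilinear F -> E -> R[i] | *%R & (Num.conj \; *%R)};
  pairing_sepF : forall f : F, (forall x : E, pairing f x = 0) -> f = 0;
  pairing_sepE : forall x : E, (forall f : F, pairing f x = 0) -> x = 0 }.

Section WeakTopologies.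
Context {R : realType} {F E : lmodType R[i]} (p : antidual_pair F E).

(* sigma(E, F) and sigma(F, E) are carried by the aliases [weakE p] of E and
   [weakF p] of F: a space is embedded into the product of copies of the
   complex numbers (with the pointwise topology) indexed by the other space.
   [R[i]^o] is the complex numbers with the topology of the modulus. *)
Definition weakE : Type :=
  initial_topology (fun (x : E) => (fun f => p f x) : {ptws F -> R[i]^o}).
Definition weakF : Type :=
  initial_topology (fun (f : F) => (fun x => p f x) : {ptws E -> R[i]^o}).

HB.instance Definition _ := Uniform.on weakE.
HB.instance Definition _ := Uniform.on weakF.

Definition weakstar_seq_complete : Prop :=
  forall u : nat -> weakF, cauchy (u @ \oo) -> exists l : weakF, u @ \oo --> l.

(* L(E; F) *)
Definition wcont_linear : set (E -> F) :=
  [set T | linear T /\ continuous (T : weakE -> weakF)].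

Definition ptwise_cvg (T : nat -> E -> F) (S : E -> F) : Prop :=
  forall x : E, ((fun n => T n x) : nat -> weakF) @ \oo --> (S x : weakF).

End WeakTopologies.

(* [pr] is not required to be an [antidual_pair], so that this also applies to
   the pairing of F * F with E * E. *)
Definition positive_op (R : realType) (F E : Type) (pr : F -> E -> R[i])
    (T : E -> F) : Prop :=
  forall x : E, 0 <= pr (T x) x.

Section Operators.
Context {R : realType} {F E : lmodType R[i]} (p : antidual_pair F E).
Implicit Types A B C D : E -> F.

Definition op_le A B : Prop := positive_op p (B - A).

Definition pairing2 (f : F * F) (x : E * E) : R[i] := p f.1 x.1 + p f.2 x.2.

Definition block_op A B C D (x : E * E) : F * F :=
  (A x.1 + B x.2, C x.1 + D x.2).

Definition block_majorant A B : set (E -> F) :=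
  [set C | [/\ wcont_linear p C, positive_op p C &
               positive_op pairing2 (block_op A B B C)]].

Definition is_complement A B C : Prop :=
  block_majorant A B C /\ forall D, block_majorant A B D -> op_le C D.

Definition complement_exists A B : Prop := exists C, is_complement A B C.

(* The complement A_B; the value is 0 when it does not exist. *)
Definition complement A B : E -> F := xget 0 (is_complement A B).

Definition parallel_sum_exists A B : Prop := complement_exists (A + B) A.

(* A : B; meaningful because (A + B)_A always exists for positive A, B. *)
Definition parallel_sum A B : E -> F := A - complement (A + B) A.

(* B \div A is defined *)
Definition parallel_diff_exists B A : Prop :=
  [/\ wcont_linear p A /\ positive_op p A,
      wcont_linear p B /\ positive_op p B,
      op_le B A & complement_exists (A - B) A].

(* B \div A; meaningful under [parallel_diff_exists B A]. *)
Definition parallel_diff B A : E -> F := complement (A - B) A - A.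

(* A << B *)
Definition abs_continuous A B : Prop :=
  forall x : nat -> E,
    ((fun n => p (B (x n)) (x n)) : nat -> R[i]^o) @ \oo --> (0 : R[i]^o) ->
    ((fun nm => p (A (x nm.1 - x nm.2)) (x nm.1 - x nm.2)) :
       nat * nat -> R[i]^o) @ (\oo, \oo) --> (0 : R[i]^o) ->
    ((fun n => p (A (x n)) (x n)) : nat -> R[i]^o) @ \oo --> (0 : R[i]^o).

Definition mutually_singular A B : Prop :=
  forall C, wcont_linear p C -> positive_op p C ->
    op_le C A -> op_le C B -> C = 0.

Definition lebesgue_decomposition A B A1 A2 : Prop :=
  [/\ A = A1 + A2,
      wcont_linear p A1 /\ positive_op p A1,
      wcont_linear p A2 /\ positive_op p A2,
      abs_continuous A1 B & mutually_singular A2 B].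

End Operators.

(* Main.v *)
Require Import Defs.
From mathcomp Require Import all_boot all_order all_algebra.
From mathcomp Require Import complex.
From mathcomp Require Import all_classical all_reals all_analysis.
From mathcomp Require Import ring lra.
Import Order.TTheory GRing.Theory Num.Theory.
Import numFieldNormedType.Exports.

Set Implicit Arguments.
Unset Strict Implicit.
Unset Printing Implicit Defensive.

Local Open Scope classical_set_scope.
Local Open Scope ring_scope.

(* Only the real forms re <T x, y> matter: replacing y by i y recovers the
   imaginary part, and positive linear operators are automatically symmetric,
   hence weakly continuous.  The complement A_B is y |-> lim B x_n, where x_n
   are approximate Riesz representers of B y for the semi-inner product A.

   Write T[y] for <T y, y>, P = A : B and Ar = P \div B.  The complement
   (B - P)_B exists because |<B x, y>|^2 <= (A + B)[y] (B - P)[x].  From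
   P[x + y] - B[x] <= (A : nB)[y] + B[x] / (n - 1) one gets
   Ar <= sup_n (A : nB).  Conversely every positive K with K <= A and
   K <= c B satisfies K <= Ar, so the forms of A : nB increase to that of Ar.
   A supremum of an increasing sequence of operators A : nB <= nB is
   B-absolutely continuous.  If C <= A - Ar and C <= B, then A : nB + C is
   below both A and (n + 1) B, hence below Ar, for all n; so Ar + C <= Ar. *)

(** * Filters in initial topologies and in topologies of pointwise convergence *)

Lemma cvg_initialP (S : choiceType) (T : topologicalType) (f : S -> T)
    (F : set_system S) (s : S) : Filter F ->
  F --> (s : initial_topology f) <-> f @ F --> f s.
Proof.
move=> FF; split=> [Fs | Fs A [_ [[B oB <-] /= Bs] BA]].
  by apply: cvg_comp Fs _; exact: initial_continuous.
by apply: filterS BA _; apply: Fs; exact: open_nbhs_nbhs.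
Qed.

Lemma cvg_ptwsP (I : Type) (T : topologicalType) (F : set_system (I -> T))
    (f : I -> T) : Filter F ->
  {ptws, F --> f} <-> forall i, (fun g => g i) @ F --> f i.
Proof.
move=> FF; rewrite cvg_sup; split=> h i; have := h i;
  [exact: (iffLR (cvg_initialP _ _ _)) | exact: (iffRL (cvg_initialP _ _ _))].
Qed.

Lemma cauchy_initialP (S : choiceType) (U : uniformType) (f : S -> U)
    (F : set_system S) : Filter F -> cauchy (f @ F) ->
  cauchy (F : set_system (initial_topology f)).
Proof.
move=> FF cF A [B eB BA]; have /= := cF B eB.
move=> [[P Q] /= [fP fQ] PQ]; exists (f @^-1` P, f @^-1` Q) => //=.
by move=> [a b] [aP bQ]; apply: BA; apply: (PQ (f a, f b)).
Qed.

(** An entourage of the pointwise uniformity contains a finite intersection of entourages that each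
    constrain a single coordinate. *)
Lemma cauchy_ptws (I : Type) (T : uniformType) (F : set_system (I -> T)) :
  Filter F -> (forall i, cauchy ((fun g => g i) @ F)) ->
  cauchy (F : set_system {ptws I -> T}).
Proof.
move=> FF cF A [B [D _ <-] BA].
apply: filterS BA _; apply: filter_bigI => -[[i V] /= /asboolP [W eW WV]] _.
have [[P Q] /= [FP FQ] PQ] := cF i W eW.
exists ((fun g : I -> T => g i) @^-1` P,
        (fun g : I -> T => g i) @^-1` Q) => //=.
by move=> [a b] [/= aP bQ]; apply: WV; apply: (PQ (a i, b i)).
Qed.

(** * Complex convergence through real and imaginary parts *)

Section ComplexTopology.
Context {R : realType}.

Lemma normc_le_ReIm (z : R[i]) :
  `|z| <= (`|complex.Re z| + `|complex.Im z|)%:C%C.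
Proof.
rewrite normc_def lecR -[leRHS]ger0_norm ?addr_ge0// -sqrtr_sqr.
rewrite ler_sqrt ?sqr_ge0//.
by rewrite sqrrD !real_normK ?num_real// lerD2r lerDl mulrn_wge0 // mulr_ge0.
Qed.

Lemma Re_continuous : continuous (fun z : R[i]^o => complex.Re z).
Proof.
move=> z A /nbhs_ballP[e /= e0 eA].
have e0' : 0 < e%:C%C :> R[i] by rewrite ltcR.
exists e%:C%C => //= w /= zw; apply: eA.
by rewrite /ball /= -raddfB /= -ltcR; apply: le_lt_trans (normc_ge_Re _) zw.
Qed.

Lemma normc_ge_Im (z : R[i]) : `|complex.Im z|%:C%C <= `|z|.
Proof. by rewrite normc_def lecR -sqrtr_sqr ler_wsqrtr// lerDr sqr_ge0. Qed.

Lemma Im_continuous : continuous (fun z : R[i]^o => complex.Im z).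
Proof.
move=> z A /nbhs_ballP[e /= e0 eA].
have e0' : 0 < e%:C%C :> R[i] by rewrite ltcR.
exists e%:C%C => //= w /= zw; apply: eA.
by rewrite /ball /= -raddfB /= -ltcR; apply: le_lt_trans (normc_ge_Im _) zw.
Qed.

Lemma cvg_complexP (T : Type) (G : set_system T) (h : T -> R[i]) (l : R[i]) :
  Filter G ->
  (h : T -> R[i]^o) @ G --> (l : R[i]^o) <->
  (complex.Re (h t) @[t --> G] --> complex.Re l) /\
  (complex.Im (h t) @[t --> G] --> complex.Im l).
Proof.
move=> FG; split=> [hl | [hR hI]].
  by split; [exact: (cvg_comp _ _ hl (@Re_continuous l)) |
             exact: (cvg_comp _ _ hl (@Im_continuous l))].
apply/cvgrPdist_lt => e e0.
have [eR eI] : 0 < complex.Re e /\ complex.Im e = 0.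
  by move: e0; rewrite ltcE /= => /andP[/eqP -> ->].
have e2 : 0 < complex.Re e / 2 by rewrite divr_gt0.
near=> t.
apply: le_lt_trans (normc_le_ReIm _) _; rewrite ltcE /= eI eqxx /=.
rewrite [ltRHS](splitr (complex.Re e)) !raddfB ltrD //; near: t.
  by move/cvgrPdist_lt : hR; apply.
by move/cvgrPdist_lt : hI; apply.
Unshelve. all: by end_near. Qed.

End ComplexTopology.

(** * The real part of the pairing *)

Lemma scale_conj_i (R : realType) (V : lmodType R[i]) (y : V) :
  'i%C^*%C *: y = - ('i%C *: y).
Proof.
rewrite -scaleNr; congr (_ *: _).
by apply/eqP; rewrite eq_complex /= oppr0 !eqxx.
Qed.

Section RealForm.
Context {R : realType} {F E : lmodType R[i]} (p : antidual_pair F E).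
Implicit Types (f g : F) (x y z : E) (T S : E -> F).

Definition re_pair f x : R := complex.Re (p f x).

Lemma conjE (z : R[i]) : Num.conj z = conjc z.
Proof. by []. Qed.

Lemma re_pairDl f g x : re_pair (f + g) x = re_pair f x + re_pair g x.
Proof. by rewrite /re_pair linearDl raddfD. Qed.
Lemma re_pairNl f x : re_pair (- f) x = - re_pair f x.
Proof. by rewrite /re_pair linearNl raddfN. Qed.
Lemma re_pairBl f g x : re_pair (f - g) x = re_pair f x - re_pair g x.
Proof. by rewrite re_pairDl re_pairNl. Qed.
Lemma re_pairZl (a : R) f x : re_pair (a%:C%C *: f) x = a * re_pair f x.
Proof.
rewrite /re_pair linearZl_LR /=; case: (p f x) => u v /=.
by rewrite mul0r subr0.
Qed.
Lemma re_pair0l x : re_pair 0 x = 0.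
Proof. by rewrite /re_pair linear0l. Qed.
Lemma re_pairDr f x y : re_pair f (x + y) = re_pair f x + re_pair f y.
Proof. by rewrite /re_pair linearDr raddfD. Qed.
Lemma re_pairNr f x : re_pair f (- x) = - re_pair f x.
Proof. by rewrite /re_pair linearNr raddfN. Qed.
Lemma re_pair0r f : re_pair f 0 = 0.
Proof. by rewrite /re_pair linear0r. Qed.
Lemma re_pairZr (a : R) f x : re_pair f (a%:C%C *: x) = a * re_pair f x.
Proof.
rewrite /re_pair linearZr_LR /= conjE conjc_real; case: (p f x) => u v /=.
by rewrite mul0r subr0.
Qed.
Lemma re_pairJ (a : R[i]) f x : re_pair (a *: f) x = re_pair f (a^*%C *: x).
Proof. by rewrite /re_pair linearZl_LR linearZr_LR /= conjE conjcK. Qed.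
Lemma re_pair_i f x : re_pair f ('i%C *: x) = complex.Im (p f x).
Proof.
rewrite /re_pair linearZr_LR /= conjE; case: (p f x) => u v /=.
by rewrite mul0r sub0r mulN1r opprK.
Qed.

Lemma re_pair_eq0 f : (forall x, re_pair f x = 0) -> f = 0.
Proof.
move=> f0; apply: (pairing_sepF (a := p)) => x; apply/eqP; rewrite eq_complex.
by rewrite -[complex.Re _]/(re_pair f x) -re_pair_i !f0 !eqxx.
Qed.

Lemma re_pair_inj f g : (forall x, re_pair f x = re_pair g x) -> f = g.
Proof.
move=> fg; apply/eqP; rewrite -subr_eq0; apply/eqP/re_pair_eq0 => x.
by rewrite re_pairBl fg subrr.
Qed.
End RealForm.

(** * Weak convergence tested on real parts *)

Section WeakConvergence.
Context {R : realType} {F E : lmodType R[i]} (p : antidual_pair F E).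

Lemma cvg_weakFP (G : set_system F) (l : F) : Filter G ->
  G --> (l : weakF p) <->
  forall x, re_pair p g x @[g --> G] --> re_pair p l x.
Proof.
move=> FG; rewrite [X in X <-> _](cvg_initialP _ _ FG) cvg_ptwsP.
split=> h x.
  by have /cvg_complexP[] := h x.
apply/cvg_complexP; split; first exact: h.
change (complex.Im (p g x) @[g --> G] --> complex.Im (p l x)).
have <- : (fun g => re_pair p g ('i%C *: x)) = (fun g => complex.Im (p g x)).
  by apply/funext => g; rewrite re_pair_i.
by have := h ('i%C *: x); rewrite re_pair_i.
Qed.

Lemma weakE_continuous (f : F) (z : E) :
  re_pair p f x @[x --> (z : weakE p)] --> re_pair p f z.
Proof.
have /cvg_initialP : (z : weakE p) --> (z : weakE p) by exact: cvg_id.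
by move=> /cvg_ptwsP /(_ f) /cvg_complexP [].
Qed.

(** Real convergence at [x] and at ['i *: x] gives complex convergence at [x], so [u] is Cauchy for
    sigma(F, E). *)
Lemma weakstar_limit (cp : weakstar_seq_complete p) (u : nat -> F) :
  (forall x, cauchy (re_pair p (u n) x @[n --> \oo])) ->
  exists l, forall x, re_pair p (u n) x @[n --> \oo] --> re_pair p l x.
Proof.
move=> cu; have [|l ul] := cp u; last first.
  by exists l => x; move/cvg_weakFP : ul; apply.
apply: cauchy_initialP; apply: cauchy_ptws => x.
apply: (@cvg_cauchy R[i]^o).
have /cauchy_cvgP/cvg_ex[a ha] := cu x.
have /cauchy_cvgP/cvg_ex[b hb] := cu ('i%C *: x).
apply/cvg_ex; exists (a +i* b)%C; apply/cvg_complexP; split => //=.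
change (complex.Im (p (u n) x) @[n --> \oo] --> b).
suff <- : (fun n => re_pair p (u n) ('i%C *: x)) =
          (fun n => complex.Im (p (u n) x)).
  exact: hb.
by apply/funext => n; rewrite re_pair_i.
Qed.

End WeakConvergence.

(** * Two elementary real inequalities *)

Lemma discriminant_le (R : realFieldType) (a b c : R) :
  0 <= c -> (forall t, 0 <= a + 2 * t * b + t ^+ 2 * c) -> b ^+ 2 <= a * c.
Proof.
move=> + h; rewrite le_eqVlt => /predU1P[c0|c_gt0].
  rewrite -c0 mulr0.
  have [->|b0] := eqVneq b 0; first by rewrite expr0n.
  (* For [c = 0] the polynomial is affine in [t], and this [t] gives it the value -1. *)
  have := h (- (a + 1) / (2 * b)).
  by rewrite -c0 mulr0 addr0 (_ : 2 * _ * b = - (a + 1)); [lra | field].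
have := h (- b / c).
rewrite (_ : a + _ + _ = (a * c - b ^+ 2) / c); last by field; rewrite gt_eqF.
by rewrite pmulr_lge0 ?invr_gt0// subr_ge0.
Qed.

(** The restriction [e <= 1] lets callers replace [e ^+ 2] by [e] and keep an error linear in
    [e]. *)
Lemma le_of_le_addeps (R : realFieldType) (a b c : R) :
  (forall e, 0 < e -> e <= 1 -> a <= b + c * e) -> a <= b.
Proof.
move=> h; rewrite leNgt; apply/negP => ba.
pose d := a - b; have d0 : 0 < d by rewrite subr_gt0.
have c0 : 0 < `|c| + d + 1 by rewrite addr_gt0// ltr_wpDl.
have e0 : 0 < d / (`|c| + d + 1) by rewrite divr_gt0.
have e1 : d / (`|c| + d + 1) <= 1.
  by rewrite ler_pdivrMr// mul1r; have := normr_ge0 c; lra.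
have := h _ e0 e1; apply/negP; rewrite -ltNge.
have : c * (d / (`|c| + d + 1)) < d; last by rewrite /d; lra.
rewrite mulrA ltr_pdivrMr//; have := ler_norm c; have := normr_ge0 c; nra.
Qed.

(** * Positive operators and their semi-inner products *)

Section PositiveOperators.
Context {R : realType} {F E : lmodType R[i]} (p : antidual_pair F E).
Implicit Types (f g : F) (x y z u v : E) (T S : E -> F).

Definition form T x y : R := re_pair p (T x) y.
(** By [posop_wcont] these are exactly the positive elements of L(E; F). *)
Definition posop T := linear T /\ positive_op p T.
Definition fnorm T x : R := Num.sqrt (form T x x).

Lemma linearfD T x y : linear T -> T (x + y) = T x + T y.
Proof. by move=> lT; have := lT 1 x y; rewrite !scale1r. Qed.

Lemma linearf0 T : linear T -> T 0 = 0.
Proof. by move=> lT; have := lT (-1) 0 0; rewrite !scaleN1r !addNr. Qed.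

Lemma linearfZ T (a : R[i]) x : linear T -> T (a *: x) = a *: T x.
Proof. by move=> lT; have := lT a x 0; rewrite (linearf0 lT) !addr0. Qed.

Section OnePositive.
Context {T : E -> F} (hT : posop T).
Let lT : linear T := hT.1.

Lemma formDl x y z : form T (x + y) z = form T x z + form T y z.
Proof. by rewrite /form linearfD // re_pairDl. Qed.
Lemma formZl (a : R) x z : form T (a%:C%C *: x) z = a * form T x z.
Proof. by rewrite /form linearfZ // re_pairZl. Qed.
Lemma formNl x z : form T (- x) z = - form T x z.
Proof. by rewrite -scaleN1r /form linearfZ // scaleN1r re_pairNl. Qed.
Lemma form_cplx (a : R[i]) x z : form T (a *: x) z = form T x (a^*%C *: z).
Proof. by rewrite /form linearfZ // re_pairJ. Qed.

Lemma form_i x : form T x ('i%C *: x) = 0.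
Proof. by rewrite /form re_pair_i; apply: ger0_Im; exact: hT.2. Qed.

Lemma form_ge0 x : 0 <= form T x x.
Proof. by have := hT.2 x; rewrite lecE /= => /andP[]. Qed.

Lemma formDr x y z : form T z (x + y) = form T z x + form T z y.
Proof. exact: re_pairDr. Qed.
Lemma formZr (a : R) x z : form T z (a%:C%C *: x) = a * form T z x.
Proof. exact: re_pairZr. Qed.
Lemma formNr x z : form T z (- x) = - form T z x.
Proof. exact: re_pairNr. Qed.

(** Polarisation: expanding [form_i] at [x + 'i y] leaves only [form T y x - form T x y]. *)
Lemma formC x y : form T x y = form T y x.
Proof.
have := form_i (x + 'i%C *: y).
have ii : 'i%C^*%C * 'i%C = 1 :> R[i].
  by apply/eqP; rewrite eq_complex /=; apply/andP; split; apply/eqP; ring.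
rewrite scalerDr scalerA -expr2 sqr_i scaleN1r formDl !(formDr, formNr) !form_i.
by rewrite !form_cplx scalerA ii scale1r scale_conj_i formNr form_i; lra.
Qed.

Definition formE := (formDl, formDr, formNl, formNr, formZl, formZr).

Lemma fnorm_ge0 x : 0 <= fnorm T x.
Proof. exact: sqrtr_ge0. Qed.

Lemma sqr_fnorm x : fnorm T x ^+ 2 = form T x x.
Proof. by rewrite sqr_sqrtr// form_ge0. Qed.

Lemma form_sqr_le x y : form T x y ^+ 2 <= form T x x * form T y y.
Proof.
apply: discriminant_le (form_ge0 y) _ => t.
by have := form_ge0 (x + t%:C%C *: y); rewrite !formE (formC y x); lra.
Qed.

Lemma form_le_fnorm x y : `|form T x y| <= fnorm T x * fnorm T y.
Proof. by rewrite -sqrtrM ?form_ge0// -sqrtr_sqr ler_wsqrtr// form_sqr_le. Qed.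

Lemma fnormD x y : fnorm T (x + y) <= fnorm T x + fnorm T y.
Proof.
rewrite -(ler_pXn2r (ltn0Sn 1)) ?nnegrE ?addr_ge0 ?fnorm_ge0//.
rewrite sqr_fnorm !formE (formC y x) sqrrD !sqr_fnorm.
by have := form_le_fnorm x y; have := ler_norm (form T x y); lra.
Qed.

(** By symmetry [form T x y] is the pairing of the fixed vector [T y] with [x], which is weakly
    continuous in [x]. *)
Lemma posop_wcont : wcont_linear p T.
Proof.
split=> // z.
have FF := @fmap_filter _ _ T _ (nbhs_filter (z : weakE p)).
apply: (iffRL (cvg_weakFP _ _ FF)) => y.
change (form T x y @[x --> (z : weakE p)] --> form T z y); rewrite formC.
suff <- : form T y = (fun x => form T x y) by exact: weakE_continuous.
by apply/funext => x; rewrite formC.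
Qed.

End OnePositive.

Lemma posopP T : linear T -> (forall x, form T x ('i%C *: x) = 0) ->
  (forall x, 0 <= form T x x) -> posop T.
Proof.
move=> lT h1 h2; split=> // x.
by rewrite lecE /= h2 -re_pair_i [X in X == _]h1 eqxx.
Qed.

Lemma posopD T S : posop T -> posop S -> posop (T + S).
Proof.
move=> hT hS; split=> [a x y|x].
  by rewrite !fctE hT.1 hS.1 scalerDr addrACA.
by rewrite !fctE linearDl addr_ge0 //; [exact: hT.2|exact: hS.2].
Qed.

Lemma posop0 : posop (0 : E -> F).
Proof.
have z x : (0 : E -> F) x = 0 by [].
by split=> [a x y|x]; rewrite !z ?linear0l// scaler0 addr0.
Qed.

Lemma posopMn T n : posop T -> posop (T *+ n).
Proof.
move=> hT; elim: n => [|n ih]; first exact: posop0.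
by rewrite mulrS; exact: posopD.
Qed.

Lemma posopB T S : posop T -> posop S ->
  (forall x, form S x x <= form T x x) -> posop (T - S).
Proof.
move=> hT hS h; apply: posopP => [a x y|x|x].
- by rewrite !fctE hT.1 hS.1 scalerBr addrACA opprD.
- rewrite /form !fctE re_pairBl.
  by rewrite [X in X - _](form_i hT) [X in _ - X](form_i hS) subr0.
- by rewrite /form !fctE re_pairBl subr_ge0 h.
Qed.

Lemma formD T S x y : form (T + S) x y = form T x y + form S x y.
Proof. by rewrite /form !fctE re_pairDl. Qed.
Lemma formB T S x y : form (T - S) x y = form T x y - form S x y.
Proof. by rewrite /form !fctE re_pairBl. Qed.
Lemma formMn T n x y : form (T *+ n) x y = n%:R * form T x y.
Proof.
elim: n => [|n ih]; first by rewrite mulr0n mul0r /form re_pair0l.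
by rewrite mulrS formD ih -natr1; ring.
Qed.

Lemma op_leP T S : posop T -> posop S ->
  op_le p T S <-> forall x, form T x x <= form S x x.
Proof.
move=> hT hS; split=> [h x|h]; last exact: (posopB hS hT h).2.
rewrite -subr_ge0 -formB; have := h x; rewrite lecE => /andP[_].
by rewrite raddf0.
Qed.

(** Cauchy-Schwarz turns a vanishing diagonal into a vanishing form. *)
Lemma posop_eq0 T : posop T -> (forall x, form T x x <= 0) -> T = 0.
Proof.
move=> hT h; apply/funext => x; apply: (re_pair_eq0 (p := p)) => y.
apply/eqP; rewrite -sqrf_eq0 eq_le sqr_ge0 andbT.
apply: le_trans (form_sqr_le hT x y) _.
by have := h x; have := form_ge0 hT y; nra.
Qed.

End PositiveOperators.

Lemma cauchy_rate (R : realType) (u d : nat -> R) :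
  (forall n m, (n <= m)%N -> `|u n - u m| <= d n) -> d @ \oo --> 0 ->
  cauchy (u @ \oo).
Proof.
move=> ud d0; apply: cauchy_exP => e e0.
have /cvgrPdist_lt/(_ e e0)[N _ hN] := d0; exists (u N).
exists N => // m /= Nm; rewrite /ball /=; apply: le_lt_trans (ud _ _ Nm) _.
apply: le_lt_trans (ler_norm _) _.
by have := hN N (leqnn N); rewrite /= sub0r normrN.
Qed.

(** * Approximate Riesz representation *)

Section ApproximateRiesz.
Context {R : realType} {F E : lmodType R[i]} {p : antidual_pair F E}.
Context {A : E -> F} (hA : posop p A).
Implicit Types (x y u : E) (e : R).

(** The variational proof of Riesz representation, stopped at an approximate maximiser [x] of [2 g u
    - A[u]]. Perturbing [x] to [x - t u] gives a quadratic in [t] that is nonnegative, and its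
    discriminant is the estimate. *)
Lemma approx_riesz (g : E -> R) (M : R) :
  (forall x y, g (x + y) = g x + g y) ->
  (forall (a : R) x, g (a%:C%C *: x) = a * g x) ->
  (forall u, 2 * g u - form p A u u <= M) ->
  forall e, 0 < e ->
  exists x, forall u, `|g u - form p A x u| <= e * fnorm p A u.
Proof.
move=> gD gZ gM e e0.
pose V := [set 2 * g u - form p A u u | u in [set: E]].
have Vsup : has_sup V.
  split; first by exists (2 * g 0 - form p A 0 0); exists 0.
  by exists M => _ [u _ <-].
(* The slack is [e ^+ 2] because the discriminant bounds the square of the error. *)
have [_ [x _ <-] hx] := sup_adherent (exprn_gt0 2 e0) Vsup.
exists x => u; have eM : e * fnorm p A u = Num.sqrt (e ^+ 2 * form p A u u).
  by rewrite sqrtrM ?sqr_ge0// sqrtr_sqr gtr0_norm.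
rewrite eM -sqrtr_sqr ler_wsqrtr//.
apply: discriminant_le (form_ge0 hA u) _ => t.
have : 2 * g (x - t%:C%C *: u) -
    form p A (x - t%:C%C *: u) (x - t%:C%C *: u) <= sup V.
  by apply: ub_le_sup; [exact: Vsup.2 | exists (x - t%:C%C *: u)].
rewrite -scaleNr -raddfN gD gZ !(formE hA) (formC hA u x); lra.
Qed.

End ApproximateRiesz.

(** * Construction of the complement *)

Local Notation normc := ComplexField.Normc.normc.

Section Complement.
Context {R : realType} {F E : lmodType R[i]} {p : antidual_pair F E}.
Context (cp : weakstar_seq_complete p).
Context {A B : E -> F} (hA : posop p A) (hB : posop p B).
Context {k : E -> R} (k_ge0 : forall y, 0 <= k y).
Hypothesis dom : forall x y, `|form p B x y| <= k y * fnorm p A x.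
Implicit Types (x y z u w : E) (e : R).

(** Here [x] plays the role of [A^-1 B y], with error [e] in the norm dual to [fnorm p A]. *)
Definition approx_rep y x e :=
  forall u, `|form p B y u - form p A x u| <= e * fnorm p A u.

Let lub_bound y u : 2 * form p B y u - form p A u u <= k y ^+ 2.
Proof.
rewrite -(sqr_fnorm hA); have := dom u y; rewrite (formC hB u y).
have := ler_norm (form p B y u); have := sqr_ge0 (k y - fnorm p A u).
by rewrite sqrrB; nra.
Qed.

Lemma approx_rep_ex y e : 0 < e -> exists x, approx_rep y x e.
Proof.
apply: (approx_riesz hA _ _ (lub_bound y)) => [x z|a x].
  exact: formDr.
exact: formZr.
Qed.

(** Both estimates are tested at [x - x'] itself, where they bound the square of its seminorm; one
    factor is then divided out. *)
Lemma approx_rep_dist y x x' e e' : 0 <= e -> 0 <= e' ->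
  approx_rep y x e -> approx_rep y x' e' -> fnorm p A (x - x') <= e + e'.
Proof.
move=> e0 e'0 /(_ (x - x')) h /(_ (x - x')) h'.
have := sqr_fnorm hA (x - x'); rewrite [RHS](formDl hA) (formNl hA) => eq.
have [n0|n0] := leP (fnorm p A (x - x')) 0.
  by apply: le_trans n0 _; rewrite addr_ge0.
rewrite -(ler_pM2r n0) -expr2 eq mulrDl.
move: h h'; rewrite !ler_norml => /andP[h1 h2] /andP[h3 h4]; lra.
Qed.

Lemma approx_rep_fnorm y x e :
  0 <= e -> approx_rep y x e -> fnorm p A x <= k y + e.
Proof.
move=> e0 /(_ x) h.
have [n0|n0] := leP (fnorm p A x) 0.
  by apply: le_trans n0 _; rewrite addr_ge0.
rewrite -(ler_pM2r n0) -expr2 (sqr_fnorm hA) mulrDl.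
have := dom x y; rewrite (formC hB x y); move: h.
by rewrite !ler_norml => /andP[h1 h2] /andP[h3 h4]; lra.
Qed.

Lemma fnormZ (a : R[i]) u : fnorm p A (a *: u) = normc a * fnorm p A u.
Proof.
rewrite /fnorm (form_cplx hA) scalerA.
have -> : a^*%C * a = (complex.Re a ^+ 2 + complex.Im a ^+ 2)%:C%C.
  case: a => b c; apply/eqP; rewrite eq_complex /=.
  by apply/andP; split; apply/eqP; ring.
rewrite formZr sqrtrM ?addr_ge0 ?sqr_ge0//; congr (_ * _).
by case: a.
Qed.

Lemma approx_rep_lin (a : R[i]) y y' x x' e e' :
  approx_rep y x e -> approx_rep y' x' e' ->
  approx_rep (a *: y + y') (a *: x + x') (normc a * e + e').
Proof.
move=> h h' u; have := h (a^*%C *: u); have := h' u.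
rewrite fnormZ (_ : normc a^*%C = normc a).
  2: by case: (a) => b c /=; rewrite sqrrN.
rewrite -(form_cplx hA) -(form_cplx hB) (formDl hA) (formDl hB) => h1 h2.
rewrite opprD addrACA; apply: le_trans (ler_normD _ _) _.
by rewrite mulrDl [_ * e]mulrC -mulrA lerD.
Qed.

(** By [dom], [B] is weakly Lipschitz for the seminorm of [A], so the images of representers of
    accuracy [1 / (n + 1)] are weak-* Cauchy. The bound on the limit covers every representer of
    [y], not only the chosen ones; linearity will rest on this. *)
Lemma limit_vector y : exists f, forall x e, 0 <= e -> approx_rep y x e ->
  forall z, `|form p B x z - re_pair p f z| <= k z * e.
Proof.
have /choice[X hX] : forall n : nat, exists x, approx_rep y x n.+1%:R^-1.
  by move=> n; apply: approx_rep_ex; rewrite invr_gt0.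
have inv0 n : 0 <= n.+1%:R^-1 :> R by rewrite invr_ge0.
have BX x e : 0 <= e -> approx_rep y x e -> forall z n,
    `|form p B x z - form p B (X n) z| <= k z * (e + n.+1%:R^-1).
  move=> e0 h z n; rewrite -(formNl hB) -(formDl hB).
  apply: le_trans (dom _ _) _.
  by rewrite ler_wpM2l// (approx_rep_dist e0 _ h (hX n)).
have h0 : (fun n => n.+1%:R^-1) @ \oo --> (0 : R) by exact: cvg_harmonic.
have [|l hl] := weakstar_limit cp (u := B \o X).
  move=> z.
  apply: (@cauchy_rate _ _ (fun n => k z * (n.+1%:R^-1 + n.+1%:R^-1))).
    move=> n m nm; apply: le_trans (BX _ _ (inv0 n) (hX n) z m) _.
    by rewrite ler_wpM2l// lerD// lef_pV2 ?posrE// ler_nat.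
  rewrite -(mulr0 (k z)) -[X in k z * X](addr0 0).
  by apply: cvgMr; apply: cvgD.
exists l => x e e0 h z.
have l1 : `|form p B x z - form p B (X n) z| @[n --> \oo] -->
    `|form p B x z - re_pair p l z|.
  by apply: cvg_norm; apply: cvgB (hl z); exact: cvg_cst.
have l2 : k z * (e + n.+1%:R^-1) @[n --> \oo] --> k z * e.
  rewrite -[X in k z * X](addr0 e); apply: cvgMr.
  by apply: cvgD h0; exact: cvg_cst.
by apply: (ler_cvg_to l1 l2); apply: nearW => n; exact: BX.
Qed.

(** [C y] is the vector of [limit_vector], heuristically [B A^-1 B y]. Each property is checked on
    representers up to a multiple of [e]. *)
Lemma complement_construct : exists C, [/\ posop p C,
    forall x y, 2 * form p B x y - form p A x x <= form p C y y &
    forall y c, (forall x, 2 * form p B x y - form p A x x <= c) ->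
      form p C y y <= c].
Proof.
have /choice[C hC] := limit_vector; exists C.
(* [<C y, z>] is close to the [A]-product of representers: [k z * e] is the cost of passing from
   [C y] to [B x], and [(k y + 1) * e] that of replacing [B z] by [A w]. *)
have CA y z x w e : 0 < e -> e <= 1 -> approx_rep y x e -> approx_rep z w e ->
    `|form p C y z - form p A x w| <= (k z + k y + 1) * e.
  move=> e0 e1 hx hw.
  have := hC y x e (ltW e0) hx z; have := hw x.
  have := approx_rep_fnorm (ltW e0) hx.
  rewrite (formC hB z x) (formC hA w x) -/(form p C y z) => n1 h2 h3.
  have {}h2 := le_trans h2 (ler_wpM2l (ltW e0) n1).
  have {}h2 : `|form p B x z - form p A x w| <= (k y + 1) * e.
    by apply: le_trans h2 _; rewrite mulrC ler_wpM2r// ?(ltW e0)// lerD2l.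
  move: h2 h3; rewrite !ler_norml => /andP[? ?] /andP[? ?].
  by apply/andP; split; lra.
(* [a *: x + x'] represents [a *: y + y'] with error [normc a * e + e], so both sides are compared
   with the same image under [B]. *)
have lC : linear C.
  move=> a y y'; apply: (re_pair_inj (p := p)) => z.
  apply/eqP; rewrite -subr_eq0 -normr_le0.
  apply: (@le_of_le_addeps _ _ _
    (k z * (normc a + 1) + k (a^*%C *: z) + k z))
    => e e0 e1; rewrite add0r.
  have [x hx] := approx_rep_ex y e0; have [x' hx'] := approx_rep_ex y' e0.
  have := hC _ _ _ (ltW e0) hx (a^*%C *: z).
  have := hC _ _ _ (ltW e0) hx' z.
  have a0 : 0 <= normc a * e + e.
    by case: (a) => b c; rewrite addr_ge0 ?mulr_ge0 ?sqrtr_ge0 ?ltW.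
  have := hC _ _ _ a0 (approx_rep_lin a hx hx') z.
  rewrite (formDl hB) (form_cplx hB) re_pairDl re_pairJ !ler_norml.
  by move=> /andP[? ?] /andP[? ?] /andP[? ?]; apply/andP; split; lra.
have pC : posop p C.
  apply: posopP => // y.
    apply/eqP; rewrite -normr_le0.
    apply: (@le_of_le_addeps _ _ _ (k ('i%C *: y) + k y + 1)) => e e0 e1.
    rewrite add0r.
    have [x hx] := approx_rep_ex y e0.
    (* Representers commute with multiplication by ['i], so [form p C y ('i y)] is close to
       [form p A x ('i x) = 0]. *)
    have hix : approx_rep ('i%C *: y) ('i%C *: x) e.
      move=> u; have := hx ('i%C^*%C *: u).
      rewrite -(form_cplx hA) -(form_cplx hB) fnormZ /=.
      by rewrite sqrrN expr1n expr0n add0r sqrtr1 mul1r.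
    by have := CA _ _ _ _ _ e0 e1 hx hix; rewrite (form_i hA) subr0.
  apply: (@le_of_le_addeps _ _ _ (k y + k y + 1)) => e e0 e1.
  have [x hx] := approx_rep_ex y e0.
  have := CA _ _ _ _ _ e0 e1 hx hx; have := form_ge0 hA x.
  by rewrite ler_norml => ? /andP[? ?]; lra.
split=> //.
  move=> x y.
  apply: (@le_of_le_addeps _ _ _ (k y + k y + 1 + 2 * fnorm p A x)) => e e0 e1.
  (* Up to the error, [2 <B x, y> - A[x]] is [A[w] - A[x - w]], and [A[w]] is [C[y]]. *)
  have [w hw] := approx_rep_ex y e0.
  have := CA _ _ _ _ _ e0 e1 hw hw; have := hw x; have := form_ge0 hA (x - w).
  rewrite !(formE hA) (formC hB x y) (formC hA w x).
  by rewrite !ler_norml => ? /andP[? ?] /andP[? ?]; lra.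
move=> y c hc.
apply: (@le_of_le_addeps _ _ _ (k y + k y + 1 + 2 * (k y + 1))) => e e0 e1.
(* The representer [w] nearly attains the supremum. *)
have [w hw] := approx_rep_ex y e0.
have := CA _ _ _ _ _ e0 e1 hw hw; have := hw w; have := hc w.
have n1 := approx_rep_fnorm (ltW e0) hw; rewrite (formC hB w y).
rewrite !ler_norml => ? /andP[? ?] /andP[? ?].
have : e * fnorm p A w <= (k y + 1) * e.
  by rewrite mulrC ler_wpM2r ?(ltW e0)//; apply: le_trans n1 _; rewrite lerD2l.
lra.
Qed.

End Complement.

(** * The complement characterised by its quadratic form *)

Section ComplementForm.
Context {R : realType} {F E : lmodType R[i]} {p : antidual_pair F E}.
Context (cp : weakstar_seq_complete p).
Implicit Types (A B C : E -> F).

(** The supremum formula for the form of [A_B]; the symmetry of [B] merges its two cross terms into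
    [2 * form p B x y]. *)
Definition lub_form A B C := [/\ posop p C,
  forall x y, 2 * form p B x y - form p A x x <= form p C y y &
  forall y c, (forall x, 2 * form p B x y - form p A x x <= c) ->
    form p C y y <= c].

(** The block form at [(x, y)] is real and equals [A[x] + 2 <B x, y> + C[y]]; then [x] is replaced
    by [- x]. *)
Lemma block_positiveP A B C : posop p A -> posop p B -> posop p C ->
  positive_op (pairing2 p) (block_op A B B C) <->
  forall x y, 2 * form p B x y - form p A x x <= form p C y y.
Proof.
move=> hA hB hC.
have ReE x y : complex.Re (pairing2 p (block_op A B B C (x, y)) (x, y)) =
    form p A x x + 2 * form p B x y + form p C y y.
  rewrite /pairing2 /= !linearDl !raddfD /= -!/(re_pair _ _ _) -!/(form p _ _ _).
  by rewrite (formC hB y x); ring.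
have ImE x y : complex.Im (pairing2 p (block_op A B B C (x, y)) (x, y)) = 0.
  rewrite /pairing2 /= !linearDl !raddfD /= -!re_pair_i -!/(form p _ _ _).
  rewrite (form_i hA) (form_i hC) (formC hB y) (form_cplx hB) scale_conj_i.
  by rewrite formNr; lra.
split=> h => [x y|[x y]].
  have := h (- x, y); rewrite lecE => /andP[_]; rewrite raddf0 ReE.
  by rewrite !(formNl hA, formNr, formNl hB); lra.
rewrite lecE ImE eqxx /= ReE; have := h (- x) y.
by rewrite !(formNl hA, formNr, formNl hB); lra.
Qed.

Lemma is_complementP A B C : posop p A -> posop p B ->
  lub_form A B C -> is_complement p A B C.
Proof.
move=> hA hB [hC ub lub]; split.
  split; [exact: posop_wcont | exact: hC.2 | exact/block_positiveP].
move=> D [[lD _] pD bD]; have hD : posop p D by [].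
by apply/op_leP => // y; apply: lub => x; move/block_positiveP : bD; apply.
Qed.

(** By minimality the form of the chosen [complement] lies below that of the constructed operator,
    hence inherits the least upper bound property. *)
Lemma complement_form A B (k : E -> R) : posop p A -> posop p B ->
  (forall y, 0 <= k y) -> (forall x y, `|form p B x y| <= k y * fnorm p A x) ->
  complement_exists p A B /\ lub_form A B (complement p A B).
Proof.
move=> hA hB k0 dom; have [C fC] := complement_construct cp hA hB k0 dom.
have hC := is_complementP hA hB fC.
have ex : complement_exists p A B by exists C.
split=> //; have [[[lD _] pD bD] Dmin] : is_complement p A B (complement p A B).
  exact: (xgetPex 0 ex).
have hD : posop p (complement p A B) by [].
split=> // [|y c h]; first exact/block_positiveP.
have [pC _ lub] := fC; apply: le_trans (lub y c h).
by have /(op_leP hD pC) := Dmin C hC.1; apply.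
Qed.

End ComplementForm.

(** * Quadratic forms of the parallel sum and the parallel difference *)

Section ParallelForms.
Context {R : realType} {F E : lmodType R[i]} {p : antidual_pair F E}.
Context (cp : weakstar_seq_complete p).
Context {A B : E -> F} (hA : posop p A) (hB : posop p B).

(** With [x] replaced by [- x], [A[y]] minus the term [2 <A x, y> - (A + B)[x]] of the supremum
    becomes [A[y + x] + B[x]]. *)
Lemma parallel_sum_form : [/\ parallel_sum_exists p A B,
  posop p (parallel_sum p A B),
  forall x y, form p (parallel_sum p A B) y y <=
    form p A (y + x) (y + x) + form p B x x &
  forall y c, (forall x, c <= form p A (y + x) (y + x) + form p B x x) ->
    c <= form p (parallel_sum p A B) y y].
Proof.
have hT := posopD hA hB.
have [|ex [hC ub lub]] := complement_form cp hT hA (@fnorm_ge0 _ _ _ p A).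
  move=> x y; apply: le_trans (form_le_fnorm hA x y) _; rewrite mulrC.
  by rewrite ler_wpM2l ?fnorm_ge0// ler_wsqrtr// formD lerDl form_ge0.
split=> //.
- apply: posopB => // y; apply: lub => x.
  have := form_ge0 hA (x - y); have := form_ge0 hB x.
  by rewrite formD !(formE hA) (formC hA y x); lra.
- move=> x y; rewrite formB; have := ub (- x) y; rewrite formD.
  by rewrite !(formE hA, formE hB) (formC hA y x); lra.
- move=> y c h; rewrite formB lerBrDr addrC -lerBrDr; apply: lub => x.
  have := h (- x); rewrite formD.
  by rewrite !(formE hA, formE hB) (formC hA y x); lra.
Qed.

Lemma parallel_diff_form (P := parallel_sum p A B) :
  [/\ parallel_diff_exists p P B,
  posop p (parallel_diff p P B),
  forall x y, form p P (x + y) (x + y) - form p B x x <=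
    form p (parallel_diff p P B) y y &
  forall y c, (forall x, form p P (x + y) (x + y) - form p B x x <= c) ->
    form p (parallel_diff p P B) y y <= c].
Proof.
have [_ hP Pub Plub] := parallel_sum_form.
rewrite -/P in hP Pub Plub.
have PB x : form p P x x <= form p B x x.
  by have := Pub (- x) x; rewrite subrr !(formE hB) /form re_pair0r; lra.
have hS : posop p (B - P) by exact: posopB.
have hT := posopD hA hB.
have [|ex [hC ub lub]] := complement_form cp hS hB (@fnorm_ge0 _ _ _ p (A + B)).
  move=> x y; rewrite -sqrtrM ?form_ge0// -sqrtr_sqr ler_wsqrtr// mulrC.
  apply: discriminant_le (form_ge0 hT y) _ => t.
  (* This trial vector in the infimum for [P[x]] gives [0 <= (B - P)[x] + 2 t <B x, y> + t^2 (A +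
     B)[y]]. *)
  have := Pub (- x - t%:C%C *: y) x; rewrite addrA subrr sub0r.
  rewrite -scaleNr -raddfN [form p (B - P) _ _]formB formD.
  by rewrite !(formE hA, formE hB) (formC hB y x); lra.
split.
- split=> //; last exact/(op_leP hP hB).
  + by split; [exact: posop_wcont | exact: hB.2].
  + by split; [exact: posop_wcont | exact: hP.2].
- apply: posopB => // y; have := ub y y; have := form_ge0 hP y.
  by rewrite [form p (B - P) _ _]formB; lra.
(* Shifting to [x + y] completes the square: [2 <B (x + y), y> - B[x + y] - B[y] = - B[x]]. *)
- move=> x y; rewrite [form p (parallel_diff _ _ _) _ _]formB.
  have := ub (x + y) y; rewrite [form p (B - P) _ _]formB.
  by rewrite !(formE hP, formE hB) (formC hB y x); lra.
- move=> y c h; rewrite [form p (parallel_diff _ _ _) _ _]formB lerBlDr.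
  apply: lub => x.
  have := h (x - y); rewrite subrK [form p (B - P) _ _]formB.
  by rewrite !(formE hP, formE hB) (formC hB y x); lra.
Qed.

End ParallelForms.

(** * The Lebesgue decomposition and its approximation by parallel sums *)

Section LebesgueDecomposition.
Context {R : realType} {F E : lmodType R[i]} {p : antidual_pair F E}.
Context (cp : weakstar_seq_complete p).
Context {A B : E -> F} (hA : posop p A) (hB : posop p B).
Let Ar := parallel_diff p (parallel_sum p A B) B.
Let An n := parallel_sum p A (B *+ n).

(* Approximates the maximiser [B^-1 K y] of the supremum defining
   [<(P \div B) y, y>], where [P = A : B]. *)
Lemma le_parallel_diff (K : E -> F) (c : R) : posop p K -> 0 <= c ->
  (forall x, form p K x x <= form p A x x) ->
  (forall x, form p K x x <= c * form p B x x) ->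
  forall y, form p K y y <= form p Ar y y.
Proof.
move=> hK c0 KA KB y.
have [_ _ _ Plub] := parallel_sum_form cp hA hB.
have [_ _ ub _] := parallel_diff_form cp hA hB.
apply: (@le_of_le_addeps _ _ _ 1) => e e0 e1; rewrite mul1r.
(* Cauchy-Schwarz for [K] with [K <= c B], then the arithmetic-geometric mean inequality. *)
have gM u : 2 * form p K y u - form p B u u <= c * form p K y y.
  have := form_sqr_le hK y u; have := KB u.
  have := form_ge0 hK y; have := form_ge0 hB u.
  move: (form p K y y) (form p B u u) (form p K u u) (form p K y u).
  move=> a b m f b0 a0 mb fa.
  have : f ^+ 2 <= (c * a) * b by apply: le_trans fa _; nra.
  have : 0 <= c * a by exact: mulr_ge0.
  by move: (c * a) => d d0 fd; have := sqr_ge0 (d - b); nra.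
have [x hx] := approx_riesz hB
  (fun u v => formDr _ u v y) (fun a u => formZr _ a u y) gM e0.
have : form p K y y + form p B x x - e <=
    form p (parallel_sum p A B) (x + y) (x + y).
  apply: Plub => w.
  (* With [w = u - x] the cross terms [2 <K y, u>] and [- 2 <B x, u>] cancel up to [2 e] times the
     seminorm of [u], which [B[u]] absorbs at the cost of [e ^+ 2]. *)
  have [u ->] : exists u, w = u - x by exists (w + x); rewrite addrK.
  have -> : x + y + (u - x) = y + u by rewrite addrC addrA subrK addrC.
  have := KA (y + u); have := hx u; have := form_ge0 hK u.
  have := sqr_fnorm hB u; have := sqr_ge0 (e - fnorm p B u).
  have : e ^+ 2 <= e by rewrite expr2 ler_piMl// ltW.
  rewrite ler_norml !(formE hK) !(formE hB) (formC hK u y) (formC hB u x) sqrrB.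
  by move=> ? ? <- ? /andP[? ?] ?; lra.
by have := ub x y; lra.
Qed.

(** The trial vector [z - x] bounds [P[x + y]] by [A[y + z] + B[z - x]]; the cross term is split
    between a large multiple of [B[z]] and a small multiple of [B[x]]. *)
Lemma parallel_diff_le_limit (c : R) (y : E) :
  (forall n, form p (An n) y y <= c) -> form p Ar y y <= c.
Proof.
move=> hc; have [_ _ _ lub] := parallel_diff_form cp hA hB.
have [_ _ Pub _] := parallel_sum_form cp hA hB.
apply: lub => x; apply: (@le_of_le_addeps _ _ _ (form p B x x)) => e e0 e1.
have [n hn] : exists n : nat, e^-1 <= n%:R.
  by exists (Num.bound e^-1); apply/ltW/archi_boundP; rewrite invr_ge0 ltW.
(* Of the [n.+1] copies of [B], one covers the [B[z]] in [B[z - x]] and the other [n], at least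
   [e^-1], cover the cross term. *)
have [_ _ _ glb] := parallel_sum_form cp hA (posopMn n.+1 hB).
rewrite lerBlDr; have := hc n.+1.
suff : form p (parallel_sum p A B) (x + y) (x + y) - form p B x x -
    form p B x x * e <= form p (An n.+1) y y by lra.
apply: glb => z; rewrite formMn.
have := Pub (z - x) (x + y).
have -> : x + y + (z - x) = y + z by rewrite addrC addrA subrK addrC.
(* AM-GM: [- 2 <Bx,z> <= e B[x] + B[z] / e] *)
have := form_ge0 hB (e%:C%C *: x + z).
have bz := form_ge0 hB z; rewrite !(formE hB) (formC hB z x) => h1 h2.
have h3 : 0 <= e * form p B x x + 2 * form p B x z + e^-1 * form p B z z.
  rewrite -(pmulr_rge0 _ e0); apply: le_trans h1 _; rewrite le_eqVlt.
  by apply/predU1P; left; field; rewrite gt_eqF.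
have := ler_wpM2r bz hn; rewrite -natr1; lra.
Qed.

Lemma posop_pdiff : posop p Ar.
Proof. by have [] := parallel_diff_form cp hA hB. Qed.

Lemma posop_psum n : posop p (An n).
Proof. by have [] := parallel_sum_form cp hA (posopMn n hB). Qed.

Lemma psum_le_l n y : form p (An n) y y <= form p A y y.
Proof.
have [_ _ ub _] := parallel_sum_form cp hA (posopMn n hB).
by have := ub 0 y; rewrite addr0 [in X in _ + X]/form re_pair0r addr0.
Qed.

Lemma psum_le_r n y : form p (An n) y y <= n%:R * form p B y y.
Proof.
have [_ _ ub _] := parallel_sum_form cp hA (posopMn n hB).
have := ub (- y) y; rewrite subrr formMn !(formE hB) opprK.
by rewrite /form re_pair0r add0r.
Qed.

Lemma psum_le_pdiff n y : form p (An n) y y <= form p Ar y y.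
Proof.
apply: (le_parallel_diff (posop_psum n) (ler0n R n)) => x.
  exact: psum_le_l.
exact: psum_le_r.
Qed.

Lemma pdiff_le y : form p Ar y y <= form p A y y.
Proof. by apply: parallel_diff_le_limit => n; exact: psum_le_l. Qed.

Lemma psum_homo n m y : (n <= m)%N -> form p (An n) y y <= form p (An m) y y.
Proof.
move=> nm.
have [_ _ ub _] := parallel_sum_form cp hA (posopMn n hB).
have [_ _ _ glb] := parallel_sum_form cp hA (posopMn m hB).
apply: glb => x; apply: le_trans (ub x y) _; rewrite lerD2l !formMn.
by rewrite ler_wpM2r ?form_ge0// ler_nat.
Qed.
(** Otherwise, by monotonicity, [Ar[x] - d] would bound every [An n]. *)
Lemma psum_approx (x : E) (d : R) : 0 < d ->
  exists N, forall n, (N <= n)%N -> form p Ar x x - form p (An n) x x <= d.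
Proof.
move=> d0; apply: contrapT => h.
have : form p Ar x x <= form p Ar x x - d; last by lra.
apply: parallel_diff_le_limit => n; rewrite leNgt; apply/negP => hn.
apply: h; exists n => m nm; have := psum_homo x nm; lra.
Qed.

(** Cauchy-Schwarz for the positive operator [Ar - An n] bounds the squared error at [z] by [(Ar -
    An n)[x]] times [Ar[z]]. *)
Lemma psum_cvg_pdiff : ptwise_cvg p An Ar.
Proof.
move=> x; apply/cvg_weakFP => z; apply/cvgrPdist_le => e e0.
have a1 : 0 < form p Ar z z + 1 by rewrite ltr_wpDl// (form_ge0 posop_pdiff).
have [N hN] := psum_approx x (divr_gt0 (exprn_gt0 2 e0) a1).
exists N => // n /= /hN h.
have hD : posop p (Ar - An n).
  by apply: posopB; [exact: posop_pdiff|exact: posop_psum|exact: psum_le_pdiff].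
suff : `|form p (Ar - An n) x z| <= e by rewrite [form p _ _ _]formB.
rewrite -(ler_pXn2r (ltn0Sn 1)) ?nnegrE ?normr_ge0 ?(ltW e0)//.
rewrite real_normK ?num_real//.
apply: le_trans (form_sqr_le hD x z) _.
rewrite [form p (_ - _) x x]formB [form p (_ - _) z z]formB.
apply: (@le_trans _ _ (e ^+ 2 / (form p Ar z z + 1) * (form p Ar z z + 1))).
  2: by rewrite divfK ?gt_eqF.
apply: ler_pM => //; rewrite ?subr_ge0 ?psum_le_pdiff//.
by have := form_ge0 (posop_psum n) z; lra.
Qed.

Lemma sub_pdiff_singular : mutually_singular p (A - Ar) B.
Proof.
move=> C [lC _] pC CA CB; have hC : posop p C by [].
have hS : posop p (A - Ar).
  by apply: posopB => //; [exact: posop_pdiff | exact: pdiff_le].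
have {}CA x : form p C x x + form p Ar x x <= form p A x x.
  by move/(op_leP hC hS)/(_ x): CA; rewrite formB; lra.
have {}CB x : form p C x x <= form p B x x by move/(op_leP hC hB)/(_ x): CB.
apply: (posop_eq0 hC) => y.
suff : form p Ar y y <= form p Ar y y - form p C y y by lra.
apply: parallel_diff_le_limit => n; rewrite lerBrDr -formD.
apply: (le_parallel_diff (c := n%:R + 1)) => [||x|x].
- by apply: posopD => //; exact: posop_psum.
- by rewrite addr_ge0.
- by rewrite formD; have := CA x; have := psum_le_pdiff n x; lra.
- by rewrite formD mulrDl mul1r lerD// psum_le_r.
Qed.

(** For fixed [n], [x m] is split as [(x m - x k) + x k] with [k] large: the first term is
    controlled by [Ar], the second by [n B]. The threshold [N1] comes from [Ar] alone, so the bound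
    is uniform in [n] and passes to the supremum. *)
Lemma pdiff_abs_continuous : abs_continuous p Ar B.
Proof.
move=> x /cvg_complexP[Bx _] /cvg_complexP[Ax _].
change (form p B (x n) (x n) @[n --> \oo] --> (0 : R)) in Bx.
change (form p Ar (x nm.1 - x nm.2) (x nm.1 - x nm.2) @[nm --> (\oo, \oo)]
  --> (0 : R)) in Ax.
apply/cvg_complexP; split; last first.
  change (complex.Im (p (Ar (x n)) (x n)) @[n --> \oo] --> (0 : R)).
  suff -> : (fun n => complex.Im (p (Ar (x n)) (x n))) = cst 0.
    exact: cvg_cst.
  by apply/funext => n; rewrite -re_pair_i; exact: (form_i posop_pdiff).
change (form p Ar (x n) (x n) @[n --> \oo] --> (0 : R)).
apply/cvgrPdist_le => e e0.
have /cvgrPdist_le/(_ e e0)[[P Q] /= [[N1 _ PN] [N2 _ QN]] PQ] := Ax.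
exists N1 => // m /= N1m.
rewrite sub0r normrN ger0_norm ?(form_ge0 posop_pdiff)//.
apply: parallel_diff_le_limit => n.
suff : fnorm p (An n) (x m) <= Num.sqrt e.
  by rewrite /fnorm ler_sqrt // ltW.
apply: (@le_of_le_addeps _ _ _ 1) => d d0 d1; rewrite mul1r.
have n0 : 0 < n%:R + 1 :> R by rewrite ltr_wpDl.
(* This tolerance makes [n B[x k]] at most [d ^+ 2]; the divisor [n + 1] is positive even for
   [n = 0]. *)
have /cvgrPdist_le/(_ _ (divr_gt0 (exprn_gt0 2 d0) n0))[N3 _ BN] := Bx.
pose k := maxn N2 N3.
have -> : x m = (x m - x k) + x k by rewrite subrK.
apply: le_trans (fnormD (posop_psum n) _ _) _; apply: lerD.
  rewrite ler_wsqrtr//; apply: le_trans (psum_le_pdiff _ _) _.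
  have /= := PQ (m, k).
  rewrite sub0r normrN ger0_norm ?(form_ge0 posop_pdiff)//.
  by apply; split; [exact: PN | apply: QN; exact: leq_maxl].
rewrite -[leRHS]ger0_norm ?(ltW d0)// -sqrtr_sqr ler_wsqrtr//.
apply: le_trans (psum_le_r _ _) _.
have /= := BN k (leq_maxr _ _).
rewrite sub0r normrN ger0_norm ?(form_ge0 hB)// => h.
apply: le_trans (ler_wpM2l (ler0n R n) h) _.
by rewrite mulrCA ler_piMr ?sqr_ge0// ler_pdivrMr// mul1r lerDl.
Qed.

End LebesgueDecomposition.

Theorem theorem2p7 (R : realType) (F E : lmodType R[i])
    (p : antidual_pair F E) (p_complete : weakstar_seq_complete p)
    (A B : E -> F)
    (A_lin : wcont_linear p A) (A_pos : positive_op p A)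
    (B_lin : wcont_linear p B) (B_pos : positive_op p B) :
  let Ar := parallel_diff p (parallel_sum p A B) B in
  [/\ parallel_sum_exists p A B,
      parallel_diff_exists p (parallel_sum p A B) B,
      wcont_linear p Ar,
      lebesgue_decomposition p A B Ar (A - Ar) &
      ptwise_cvg p (fun n => parallel_sum p A (B *+ n)) Ar].
Proof.
have hA : posop p A by split; [exact: A_lin.1 | exact: A_pos].
have hB : posop p B by split; [exact: B_lin.1 | exact: B_pos].
move=> Ar.
have [sum_ex _ _ _] := parallel_sum_form p_complete hA hB.
have [diff_ex hAr _ _] := parallel_diff_form p_complete hA hB.
have hS : posop p (A - Ar) by apply: posopB => //; exact: pdiff_le.
split=> //; first exact: posop_wcont; last exact: psum_cvg_pdiff.
split.
- by rewrite addrC subrK.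
- by split; [exact: posop_wcont | exact: hAr.2].
- by split; [exact: posop_wcont | exact: hS.2].
- exact: pdiff_abs_continuous.
- exact: sub_pdiff_singular.
Qed.
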